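(* Let $\beta$ be a Parry number and $\chi$ a beta-conjugate of $\beta$ whose minimal polynomial, of degree $n$, is non-cyclotomic; let $\chi_0=\chi,\chi_1,\ldots,\chi_{n-1}$ be its roots. If $|\chi_j|\leq 1+\frac{0.1}{n^2}$ for all $j=0,1,\ldots,n-1$, then $|\chi_j|=1$ for at least one $j$.
   Context: For non-integer $\beta>1$, $d_\beta(1)=0.t_1t_2\ldots$ with $t_1=\lfloor\beta\rfloor$, $t_{j+1}=\lfloor\beta T_\beta^j(1)\rfloor$, $T_\beta(x)=\beta x-\lfloor\beta x\rfloor$; $\beta$ is a Parry number if $(t_i)$ is eventually periodic. Parry polynomial: if $t_i=0$ for $i>m$, $t_m\neq0$: $n_\beta^*(X)=X^m-\sum_{i=1}^mt_iX^{m-i}$; otherwise with minimal preperiod $m\ge0$ and period $p+1$: if $m\ge1$, $n_\beta^*(X)=X^{m+p+1}-\sum_{i=1}^{m+p+1}t_iX^{m+p+1-i}-X^m+\sum_{i=1}^mt_iX^{m-i}$; if $m=0$, $n_\beta^*(X)=X^{p+1}-\sum_{i=1}^pt_iX^{p+1-i}-(1+t_{p+1})$. A beta-conjugate of $\beta$ is a root of $n_\beta^*$ which is not a root of the minimal polynomial of $\beta$. *)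

(* Defs.v *)
From HB Require Import structures.
From mathcomp Require Import all_boot all_order all_algebra all_field.
From mathcomp Require Import reals complex.

Set Implicit Arguments.
Unset Strict Implicit.
Unset Printing Implicit Defensive.

Import Order.TTheory GRing.Theory Num.Theory.

Local Open Scope ring_scope.

Definition beta_map (R : realType) (b x : R) : R :=
  b * x - (Num.floor (b * x))%:~R.

(* t_i = floor (b * T_b^(i-1) 1), indexed from i = 1 as in d_b(1) = 0.t_1t_2...;
   the value at i = 0 is junk and is never used below. *)
Definition beta_digit (R : realType) (b : R) (i : nat) : int :=
  Num.floor (b * iter i.-1 (beta_map b) 1).

(* The sequence t_1, t_2, ... has m as a preperiod length and l as a period
   length of the tail t_(m+1), t_(m+2), ... *)
Definition preperiod_period (t : nat -> int) (m l : nat) : Prop :=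
  (0 < l)%N /\ forall i, (m < i)%N -> t (i + l)%N = t i.

Definition eventually_periodic (t : nat -> int) : Prop :=
  exists m l, preperiod_period t m l.

Definition minimal_preperiod_period (t : nat -> int) (m l : nat) : Prop :=
  preperiod_period t m l /\
  forall m' l', preperiod_period t m' l' -> (m <= m')%N /\ (l <= l')%N.

Definition parry_number (R : realType) (b : R) : Prop :=
  [/\ 1 < b, b \isn't a Num.int & eventually_periodic (beta_digit b)].

Definition finite_of_length (t : nat -> int) (m : nat) : Prop :=
  [/\ (0 < m)%N, t m != 0 & forall i, (m < i)%N -> t i = 0].

Definition simple_parry_poly (t : nat -> int) (m : nat) : {poly int} :=
  'X^m - \sum_(1 <= i < m.+1) t i *: 'X^(m - i).

Definition nonsimple_parry_poly (t : nat -> int) (m p : nat) : {poly int} :=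
  if m == 0%N then
    'X^(p.+1) - \sum_(1 <= i < p.+1) t i *: 'X^(p.+1 - i) - (1 + t p.+1)%:P
  else
    'X^(m + p.+1) - \sum_(1 <= i < (m + p.+1).+1) t i *: 'X^(m + p.+1 - i)
    - 'X^m + \sum_(1 <= i < m.+1) t i *: 'X^(m - i).

Definition is_parry_poly (R : realType) (b : R) (q : {poly int}) : Prop :=
  let t := beta_digit b in
  (exists2 m, finite_of_length t m & q = simple_parry_poly t m) \/
  ((~ exists m, finite_of_length t m) /\
   exists m p, minimal_preperiod_period t m p.+1 /\
               q = nonsimple_parry_poly t m p).

(* P is the monic generator of the ideal of rational polynomials vanishing
   at z (same specification as minCpolyP, for an arbitrary field F). *)
Definition is_minpoly (F : numFieldType) (P : {poly rat}) (z : F) : Prop :=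
  P \is monic /\ forall Q : {poly rat}, root (map_poly ratr Q) z = (P %| Q).

Definition is_cyclotomic (P : {poly rat}) : Prop :=
  exists2 k, (0 < k)%N & P = map_poly intr 'Phi_k.

Definition beta_conjugate (R : realType) (b : R) (z : R[i]) : Prop :=
  (exists2 q, is_parry_poly b q & root (map_poly intr q) z) /\
  (exists2 P, is_minpoly P b & ~~ root (map_poly ratr P) z).

(* Main.v *)
Require Import Defs.
From HB Require Import structures.
From mathcomp Require Import all_boot all_order all_algebra all_field.
From mathcomp Require Import reals complex.
From mathcomp Require Import zify ring lra.

Set Implicit Arguments.
Unset Strict Implicit.
Unset Printing Implicit Defensive.

Import Order.TTheory GRing.Theory Num.Theory.

Local Open Scope ring_scope.

(** Let [x_0, ..., x_(n-1)] be the conjugates of [chi], which is a nonzero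
    algebraic integer since Parry polynomials are monic with nonzero constant
    term.  The integer polynomials [R_a = prod_j (1 - x_j^(2^a) X)] are iterated
    Graeffe transforms of one another, so [R_(a+1) = R_a] modulo [2^(a+1)], and
    by Newton's identities their power sums [S_k] satisfy the same congruence.
    Choose [a] with [2^a < 4n <= 2^(a+1)].  The hypothesis on the [|x_j|] makes
    the two power sums differ by less than [4n] for [k <= n], so they are equal,
    hence [R_(a+1) = R_a].  Squaring thus maps the finite set of the
    [x_j^(2^a)] to itself, and an orbit that repeats forces [|chi| = 1].  This is
    Dobrowolski's argument with the modulus [2^(a+1)] in place of a prime. *)

(** * Reciprocal products, power sums and Newton's identities *)

Section ReciprocalProduct.
Variable F : comNzRingType.
Implicit Types (n k : nat) (x : nat -> F).

Definition recip_prod n x : {poly F} := \prod_(j < n) (1 - x j *: 'X).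

Definition power_sum n x k : F := \sum_(j < n) x j ^+ k.

Lemma coef_recip_prodS n x i :
  (recip_prod n.+1 x)`_i.+1
    = (recip_prod n x)`_i.+1 - x n * (recip_prod n x)`_i.
Proof.
by rewrite /recip_prod big_ord_recr /= mulrBr mulr1 coefB -scalerAr coefZ coefMX.
Qed.

Lemma coef0_recip_prod n x : (recip_prod n x)`_0 = 1.
Proof.
elim: n => [|n IHn]; first by rewrite /recip_prod big_ord0 coef1.
rewrite /recip_prod big_ord_recr /= mulrBr mulr1 coefB -scalerAr coefZ coefMX.
by rewrite mulr0 subr0.
Qed.

Lemma size_recip_prod n x : (size (recip_prod n x) <= n.+1)%N.
Proof.
elim: n => [|n IHn]; first by rewrite /recip_prod big_ord0 size_poly1.
apply/leq_sizeP => -[//|i] lt_n_i.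
have le_size : (size (recip_prod n x) <= i)%N by apply: leq_trans IHn _.
by rewrite coef_recip_prodS !nth_default ?mulr0 ?subr0 // leqW.
Qed.

(** The reversal of the monic polynomial with roots [x j]: integrality of a minimal polynomial
    passes to [recip_prod] through this identity. *)
Lemma coef_recip_prod n x i : (i <= n)%N ->
  (recip_prod n x)`_i = (\prod_(j < n) ('X - (x j)%:P))`_(n - i).
Proof.
elim: n i => [|n IHn] i le_i_n.
  by rewrite /recip_prod !big_ord0 !coef1; case: i le_i_n.
have coefS j : (\prod_(j < n.+1) ('X - (x j)%:P))`_j
    = (\prod_(j < n) ('X - (x j)%:P) * 'X)`_j
      - x n * (\prod_(j < n) ('X - (x j)%:P))`_j.
  by rewrite big_ord_recr /= mulrBr coefB coefMC mulrC [_ * x n]mulrC.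
have size_prod : size (\prod_(j < n) ('X - (x j)%:P)) = n.+1.
  by rewrite size_prod_XsubC /index_enum -enumT size_enum_ord.
rewrite coefS coefMX; case: i le_i_n => [|i] le_i_n.
  rewrite subn0 coef0_recip_prod /= [X in x n * X]nth_default ?size_prod //.
  by rewrite mulr0 subr0 -[X in _`_X](subn0 n) -IHn // coef0_recip_prod.
rewrite coef_recip_prodS subSS -IHn //; congr (_ - _).
move: le_i_n; rewrite ltnS leq_eqVlt => /predU1P[->|lt_i_n].
  by rewrite subnn nth_default // size_recip_prod.
by rewrite IHn // subn_eq0 leqNgt lt_i_n /= subnS.
Qed.

(* The reciprocal normalisation makes Newton's identities uniform in [k]: the
   coefficients beyond [n] vanish, so [k > n] needs no separate case. *)
Lemma newton_identity n x k :
  \sum_(i < k) (recip_prod n x)`_i * power_sum n x (k - i)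
    + (recip_prod n x)`_k *+ k = 0.
Proof.
elim: n k => [|n IHn] k.
  rewrite big1 => [|i _]; last by rewrite /power_sum big_ord0 mulr0.
  by rewrite /recip_prod big_ord0 coef1 add0r; case: k => //= k; rewrite mul0rn.
case: k => [|k]; first by rewrite big_ord0 mulr0n addr0.
have psumS m : power_sum n.+1 x m = power_sum n x m + x n ^+ m.
  by rewrite /power_sum big_ord_recr.
under eq_bigr do rewrite psumS mulrDr.
rewrite big_split /=.
have -> : \sum_(i < k.+1) (recip_prod n.+1 x)`_i * power_sum n x (k.+1 - i)
   = \sum_(i < k.+1) (recip_prod n x)`_i * power_sum n x (k.+1 - i)
     - x n * \sum_(i < k) (recip_prod n x)`_i * power_sum n x (k - i).
  rewrite !big_ord_recl !coef0_recip_prod -addrA; congr (_ + _).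
  rewrite mulr_sumr -sumrB; apply: eq_bigr => i _.
  by rewrite !lift0 coef_recip_prodS !subSS mulrBl mulrA.
(* By [coef_recip_prodS] the sum telescopes, and only the last term survives. *)
have -> : \sum_(i < k.+1) (recip_prod n.+1 x)`_i * x n ^+ (k.+1 - i)
    = (recip_prod n x)`_k * x n.
  elim: k => [|k IHk]; first by rewrite big_ord1 !coef0_recip_prod subn0.
  rewrite big_ord_recr /= subSnn expr1.
  under eq_bigr => i _ do rewrite subSn 1?ltnW // exprS mulrCA.
  rewrite -mulr_sumr IHk coef_recip_prodS; ring.
have := IHn k.+1; move/eqP; rewrite addr_eq0 => /eqP->.
have := IHn k; move/eqP; rewrite addr_eq0 => /eqP->.
rewrite coef_recip_prodS !mulrSr; ring.
Qed.

End ReciprocalProduct.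

(** * Graeffe transforms and their congruences modulo powers of 2 *)

Section Graeffe.
Variable F : comNzRingType.
Implicit Types p : {poly F}.

(* The [q] with [q(X^2) = p(X) p(-X)], see [graeffe_comp]. *)
Definition graeffe p : {poly F} := even_poly p ^+ 2 - 'X * odd_poly p ^+ 2.

Lemma comp_polyX2_inj : injective (fun p => p \Po 'X^2).
Proof.
move=> p q /= eq_pq; apply/polyP => i.
have := congr1 (fun r : {poly F} => r`_(2 * i)) eq_pq.
by rewrite /= !coef_comp_poly_Xn // dvdn_mulr // mulKn.
Qed.

Lemma graeffe_comp p : graeffe p \Po 'X^2 = p * (p \Po - 'X).
Proof.
have eNX (q : {poly F}) : (q \Po 'X^2) \Po (- 'X) = q \Po 'X^2.
  by rewrite -comp_polyA comp_Xn_poly sqrrN.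
rewrite /graeffe !expr2 comp_polyB !comp_polyM comp_polyX.
rewrite -[p in RHS]poly_even_odd comp_polyD comp_polyM !eNX comp_polyX.
ring.
Qed.

(** After substituting ['X^2], this is (1 - cX)(1 + cX) = 1 - c^2 X^2, factor by factor. *)
Lemma graeffe_recip_prod n (x : nat -> F) :
  graeffe (recip_prod n x) = recip_prod n (fun j => x j ^+ 2).
Proof.
apply: comp_polyX2_inj; rewrite graeffe_comp /recip_prod.
rewrite !rmorph_prod -big_split; apply: eq_bigr => j _ /=.
rewrite !comp_polyB !comp_polyC !comp_polyZ !comp_polyX.
by rewrite -!mul_polyC rmorphXn polyC1 /=; ring.
Qed.

End Graeffe.

Arguments graeffe {F} p.

Lemma map_graeffe (F G : comNzRingType) (f : {rmorphism F -> G}) (p : {poly F}) :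
  map_poly f (graeffe p) = graeffe (map_poly f p).
Proof.
have map_even : map_poly f (even_poly p) = even_poly (map_poly f p).
  by apply/polyP => i; rewrite coef_even_poly !coef_map coef_even_poly.
have map_odd : map_poly f (odd_poly p) = odd_poly (map_poly f p).
  by apply/polyP => i; rewrite coef_odd_poly !coef_map coef_odd_poly.
by rewrite /graeffe !expr2 rmorphB !rmorphM /= map_polyX map_even map_odd.
Qed.

(** Frobenius modulo 2: cross terms of the square are even, and c^2 = c modulo 2 for every
    coefficient c. *)
Lemma sqr_poly_mod2 (p : {poly int}) : exists q, p ^+ 2 = (p \Po 'X^2) + 2 *: q.
Proof.
elim/poly_ind: p => [|p c [q Dq]].
  by exists 0; rewrite comp_poly0 expr0n scaler0 addr0.
have [d Dd] : exists d, c ^+ 2 = c + 2 * d.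
  have [e [->|->]] : exists e, c = 2 * e \/ c = 2 * e + 1.
    by exists (c %/ 2)%Z; lia.
  - by exists (2 * e ^+ 2 - e); ring.
  - by exists (2 * e ^+ 2 + e); ring.
exists (q * 'X^2 + c *: p * 'X + d%:P).
rewrite comp_polyD comp_polyM comp_polyC comp_polyX sqrrD exprMn Dq.
have -> : c%:P ^+ 2 = c%:P + 2 * d%:P :> {poly int}.
  by rewrite -rmorphXn Dd rmorphD /= mulr_natl rmorphMn mulr_natl.
rewrite !scaler_nat -mul_polyC; ring.
Qed.

(** With E and O the even and odd parts, Frobenius turns E^2 - X O^2 into E(X^2) - X O(X^2), which
    is [p] up to a sign invisible modulo 2. *)
Lemma graeffe_mod2 (p : {poly int}) : exists q, graeffe p = p + 2 *: q.
Proof.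
have [qe De] := sqr_poly_mod2 (even_poly p).
have [qo Do] := sqr_poly_mod2 (odd_poly p).
exists (qe - 'X * qo - (odd_poly p \Po 'X^2) * 'X).
rewrite /graeffe De Do !scaler_nat.
rewrite -[X in _ = X + _]poly_even_odd.
ring.
Qed.

(** Squaring gains one factor 2: for M = 2^(a+1), (r + M f)^2 = r^2 + 2M (r f + 2^a f^2). The
    bracket is [h r f], used on the even and odd parts. *)
Lemma graeffe_lift (a : nat) (p q f : {poly int}) :
  p = q + 2 ^+ a.+1 *: f -> exists g, graeffe p = graeffe q + 2 ^+ a.+2 *: g.
Proof.
move=> ->; pose h r f' : {poly int} := r * f' + 2 ^+ a *: f' ^+ 2.
exists (h (even_poly q) (even_poly f) - 'X * h (odd_poly q) (odd_poly f)).
rewrite /graeffe /h even_polyD odd_polyD even_polyZ odd_polyZ -!mul_polyC.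
rewrite !exprS !rmorphM /=.
have -> : (2 : int)%:P = 2 by rewrite rmorph_nat.
ring.
Qed.

Lemma iter_graeffe_cong (a : nat) (p : {poly int}) :
  exists f, iter a.+1 graeffe p = iter a graeffe p + 2 ^+ a.+1 *: f.
Proof.
elim: a => [|a [f]]; first exact: graeffe_mod2.
exact: graeffe_lift.
Qed.

(** * Congruences between integers embedded in a ring, and their transfer to and from power sums *)

Section IntegerCongruence.
Variables (F : comNzRingType) (m : int).

(** Carrying integer witnesses proves integrality of the power sums along with their congruence. *)
Definition int_cong (u v : F) : Prop :=
  exists s d : int, u = (s + m * d)%:~R /\ v = s%:~R.

Lemma int_cong_refl (s : int) : int_cong s%:~R s%:~R.
Proof. by exists s, 0; rewrite mulr0 addr0. Qed.

Lemma int_congD u v u' v' :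
  int_cong u v -> int_cong u' v' -> int_cong (u + u') (v + v').
Proof.
move=> [s [d [-> ->]]] [s' [d' [-> ->]]]; exists (s + s'), (d + d').
by rewrite -!rmorphD /=; split=> //; congr _%:~R; ring.
Qed.

Lemma int_congM u v u' v' :
  int_cong u v -> int_cong u' v' -> int_cong (u * u') (v * v').
Proof.
move=> [s [d [-> ->]]] [s' [d' [-> ->]]].
exists (s * s'), (s * d' + d * s' + m * d * d').
by rewrite -!rmorphM /=; split=> //; congr _%:~R; ring.
Qed.

Lemma int_congN u v : int_cong u v -> int_cong (- u) (- v).
Proof.
by move=> uv; rewrite -mulN1r -[- v]mulN1r; apply: int_congM (int_cong_refl (-1)) uv.
Qed.

(** Since the constant coefficient is 1, Newton's identities yield each power sum from earlier ones
    without division, so they respect congruences. *)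
Lemma power_sum_cong n (x y : nat -> F) :
    (forall i, int_cong (recip_prod n x)`_i (recip_prod n y)`_i) ->
  forall k, int_cong (power_sum n x k) (power_sum n y k).
Proof.
move=> cong_xy k; elim/ltn_ind: k => -[_|k IHk].
  have psum0 z : power_sum n z 0 = n%:R.
    by rewrite -{2}(card_ord n) -sumr_const; apply: eq_bigr => j _; rewrite expr0.
  by rewrite !psum0; apply: (int_cong_refl n).
have psumE z : power_sum n z k.+1 = - (\sum_(i < k) (recip_prod n z)`_i.+1
    * power_sum n z (k - i) + (recip_prod n z)`_k.+1 *+ k.+1).
  apply/eqP; rewrite -addr_eq0 -[X in _ == X](newton_identity n z k.+1).
  by rewrite big_ord_recl coef0_recip_prod mul1r subn0 addrA.
rewrite !psumE; apply/int_congN/int_congD.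
  elim/big_ind2: _ => [|????|i _]; first exact: (int_cong_refl 0).
    exact: int_congD.
  by apply: int_congM => //; apply: IHk; rewrite ltnS leq_subr.
rewrite -mulr_natr -[X in int_cong _ X]mulr_natr.
by apply: int_congM => //; apply: (int_cong_refl k.+1).
Qed.

End IntegerCongruence.

(** Newton's identities read the other way: they determine [k] times the [k]-th coefficient, and [k]
    cancels in characteristic 0. *)
Lemma eq_recip_prod (F : numDomainType) n (x y : nat -> F) :
    (forall k, (0 < k <= n)%N -> power_sum n x k = power_sum n y k) ->
  recip_prod n x = recip_prod n y.
Proof.
move=> eq_xy; apply/polyP => k.
have [le_k_n|lt_n_k] := leqP k n; last first.
  by rewrite !nth_default // (leq_trans (size_recip_prod _ _)).
elim/ltn_ind: k le_k_n => -[|k] IHk le_k_n; first by rewrite !coef0_recip_prod.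
apply: (pmulrnI (ltn0Sn k)); rewrite /=.
have /eqP := newton_identity n x k.+1; rewrite addrC addr_eq0 => /eqP->.
have /eqP := newton_identity n y k.+1; rewrite addrC addr_eq0 => /eqP->.
congr (- _); apply: eq_bigr => i _; rewrite IHk ?eq_xy //; last first.
  exact: leq_trans (ltnW (ltn_ord i)) le_k_n.
by rewrite subn_gt0 ltn_ord (leq_trans (leq_subr _ _)).
Qed.

(** * Numerical bounds for the constant 0.1 *)

(** A Bernoulli-type upper bound kept free of division; the induction step is (1 + u)(1 - (M+1)u) =
    1 - Mu - (M+1)u^2. *)
Lemma expr_near1_le (F : realFieldType) (u : F) (M : nat) :
  0 <= u -> (1 + u) ^+ M * (1 - M%:R * u) <= 1.
Proof.
move=> u_ge0; elim: M => [|M IHM]; first by rewrite expr0 mul0r subr0 mulr1.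
apply: le_trans IHM; rewrite exprSr -mulrA ler_wpM2l ?exprn_ge0 ?addr_ge0 //.
have : 0 <= M.+1%:R * u ^+ 2 by rewrite mulr_ge0 ?exprn_ge0.
by rewrite -natr1; lra.
Qed.

(** The exponents are those reached by the two power sums. As n^2 times 0.1/n^2 is 1/10,
    [B ^+ (n ^ 2)] is at most 10/9. *)
Lemma house_bound_real (F : realFieldType) (n : nat)
    (B := 1 + 1 / 10%:R / n%:R ^+ 2 : F) :
  (0 < n)%N -> B ^+ (4 * n ^ 2) + B ^+ (8 * n ^ 2) < 4.
Proof.
move=> n_gt0; have nN0 : (n%:R : F) != 0 by rewrite pnatr_eq0 -lt0n.
have u_ge0 : 0 <= 1 / 10%:R / n%:R ^+ 2 :> F by rewrite ?divr_ge0 ?exprn_ge0.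
have B_ge0 : 0 <= B by rewrite addr_ge0.
have le_BN : B ^+ (n ^ 2) <= 10%:R / 9%:R.
  have := @expr_near1_le _ _ (n ^ 2) u_ge0.
  rewrite -/B natrX (_ : 1 - _ = 9%:R / 10%:R); first lra.
  by field.
rewrite (mulnC 8) (mulnC 4) (exprM _ _ 8) (exprM _ _ 4).
have : 0 <= B ^+ (n ^ 2) by apply: exprn_ge0.
move: (B ^+ (n ^ 2)) le_BN => C le_C C_ge0.
have le_C2 : C ^+ 2 <= (10%:R / 9%:R) ^+ 2 by rewrite lerXn2r ?nnegrE ?divr_ge0.
(* 1.53 rounds (10/9)^4 up, and 1.53 + 1.53^2 = 3.8709 is still below 4. *)
have le_C4 : C ^+ 4 <= 153%:R / 100%:R.
  have : (C ^+ 2) ^+ 2 <= ((10%:R / 9%:R) ^+ 2) ^+ 2.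
    by rewrite lerXn2r ?nnegrE ?exprn_ge0 ?divr_ge0.
  by rewrite -!exprM => /le_trans; apply; lra.
have : (C ^+ 4) ^+ 2 <= (153%:R / 100%:R) ^+ 2.
  by rewrite lerXn2r ?nnegrE ?exprn_ge0 ?divr_ge0.
rewrite (_ : C ^+ 8 = (C ^+ 4) ^+ 2); last by rewrite -exprM.
by move: (C ^+ 4) le_C4 => D le_D le_D2; lra.
Qed.

(** [R[i]] is only partially ordered, so the inequality is proved over [rat] and transported. *)
Lemma house_bound (F : numFieldType) (n : nat)
    (B := 1 + 1 / 10%:R / n%:R ^+ 2 : F) :
  (0 < n)%N -> B ^+ (4 * n ^ 2) + B ^+ (8 * n ^ 2) < 4.
Proof.
move=> n_gt0; have := house_bound_real rat n_gt0.
have : ratr (1 + 1 / 10%:R / n%:R ^+ 2) = B.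
  by rewrite rmorphD rmorph1 !fmorph_div rmorphXn rmorph1 !rmorph_nat.
move: (1 + 1 / 10%:R / n%:R ^+ 2) => Bq <-.
by rewrite -(ltr_rat F) rmorphD /= !rmorphXn /= rmorph_nat.
Qed.

(** * Integer reciprocal products whose parameters barely leave the unit disc *)

Section SmallHouse.
Variables (F : numFieldType) (n : nat) (x : nat -> F) (r : {poly int}).
Hypothesis n_gt0 : (0 < n)%N.
Hypothesis int_prod : map_poly intr r = recip_prod n x.
Hypothesis x_le : forall j, (j < n)%N -> `|x j| <= 1 + (1 / 10%:R) / n%:R ^+ 2.

Lemma iter_graeffe_recip_prod a :
  map_poly intr (iter a graeffe r) = recip_prod n (fun j => x j ^+ (2 ^ a)).
Proof.
elim: a => [|a IHa]; first by rewrite int_prod.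
rewrite iterS map_graeffe IHa graeffe_recip_prod; apply: eq_bigr => j _.
by rewrite -exprM -expnSr.
Qed.

Lemma power_sum_expn_cong a k :
  int_cong (2 ^+ a.+1) (power_sum n (fun j => x j ^+ (2 ^ a.+1)) k)
                       (power_sum n (fun j => x j ^+ (2 ^ a)) k).
Proof.
apply: power_sum_cong => i; rewrite -!iter_graeffe_recip_prod !coef_map.
have [f ->] := iter_graeffe_cong a r.
by exists (iter a graeffe r)`_i, f`_i; rewrite coefD coefZ.
Qed.

Lemma norm_power_sum_le a k N : (2 ^ a * k <= N)%N ->
  `|power_sum n (fun j => x j ^+ (2 ^ a)) k|
    <= n%:R * (1 + (1 / 10%:R) / n%:R ^+ 2) ^+ N.
Proof.
move=> le_N; apply: le_trans (ler_norm_sum _ _ _) _.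
rewrite mulr_natl -[X in _ *+ X](card_ord n) -sumr_const.
apply: ler_sum => j _; rewrite -exprM normrX.
have B_ge1 : 1 <= 1 + (1 / 10%:R) / n%:R ^+ 2 :> F.
  by rewrite lerDl ?divr_ge0 ?exprn_ge0.
apply: le_trans (ler_weXn2l B_ge1 le_N).
by rewrite lerXn2r ?nnegrE ?normr_ge0 ?x_le // (le_trans ler01).
Qed.

Lemma exists_stable_exponent :
  exists a, recip_prod n (fun j => x j ^+ (2 ^ a.+1))
          = recip_prod n (fun j => x j ^+ (2 ^ a)).
Proof.
(* The left inequality keeps the exponents within [house_bound]; the right one makes the modulus at
   least the bound on the difference. *)
have [a /andP[lt_a le_a]] : exists a, (2 ^ a < 4 * n <= 2 ^ a.+1)%N.
  have lt1 : (1 < 4 * n)%N by lia.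
  have := up_log_bounds (isT : (1 < 2)%N) lt1.
  case: up_log => [|a]; first by lia.
  by exists a.
exists a; apply: eq_recip_prod => k /andP[k_gt0 le_k_n].
have [s [d [Ds' Ds]]] := power_sum_expn_cong a k.
suff d0 : d = 0 by rewrite Ds' Ds d0 mulr0 addr0.
have le_a4 : (2 ^ a * k <= 4 * n ^ 2)%N.
  by rewrite (leq_trans (leq_mul (ltnW lt_a) le_k_n)) // -mulnA mulnn.
have le_a8 : (2 ^ a.+1 * k <= 8 * n ^ 2)%N.
  by rewrite expnS -mulnA (_ : 8 = 2 * 4)%N // -mulnA leq_mul2l.
have := le_trans (ler_normB _ _)
  (lerD (norm_power_sum_le le_a8) (norm_power_sum_le le_a4)).
rewrite Ds Ds' -mulrDr -rmorphB addrC addKr => le_d.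
have lt_d : `|(2 ^+ a.+1 * d)%:~R| < (n * 4)%:R :> F.
  apply: le_lt_trans le_d _; rewrite natrM ltr_pM2l ?ltr0n // addrC.
  exact: house_bound.
move: lt_d; rewrite -intr_norm [X in _ < X]pmulrn ltr_int normrM normrX.
(* A nonzero multiple of [2 ^ a.+1] has absolute value at least [4 * n]. *)
case: (eqVneq d 0) => // dN0; rewrite ltNge => /negP[].
apply: le_trans (_ : (2 ^ a.+1)%N%:Z * `|d| <= _); last by rewrite normr_nat -natrX natz.
have : 1 <= `|d| by rewrite -gtz0_ge1 normr_gt0.
have : (n * 4)%N%:Z <= (2 ^ a.+1)%N%:Z by rewrite lez_nat mulnC.
by move: (2 ^ a.+1)%N => q; nia.
Qed.

Lemma norm_small_house : x 0 != 0 -> `|x 0| = 1.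
Proof.
move=> x0_neq0; have [a eq_a] := exists_stable_exponent.
pose y j := x j ^+ (2 ^ a).
have sqr_closed j : (j < n)%N -> y j != 0 ->
    exists2 i, (i < n)%N & y j ^+ 2 = y i.
  move=> lt_j_n yj_neq0; have yj2_neq0 : y j ^+ 2 != 0 by apply: expf_neq0.
  (* Roots of a reciprocal product are inverses of its nonzero parameters, so this root must also
     come from some [y i]. *)
  have : (recip_prod n (fun j => x j ^+ (2 ^ a.+1))).[(y j ^+ 2)^-1] = 0.
    rewrite /recip_prod (bigD1 (Ordinal lt_j_n)) //= hornerM !hornerE.
    rewrite (_ : x j ^+ _ = y j ^+ 2); last by rewrite -exprM -expnSr.
    by rewrite divff // subrr mul0r.
  rewrite eq_a /recip_prod horner_prod => /eqP.
  rewrite prodf_seq_eq0 => /hasP[i _]; rewrite /= !hornerE subr_eq0.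
  move=> /eqP Di; exists i => //.
  by rewrite -[LHS]mul1r Di -/(y i) mulfVK.
have orbit m : exists2 i, (i < n)%N & y 0 ^+ (2 ^ m) = y i.
  elim: m => [|m [i lt_i_n Di]]; first by exists 0; rewrite ?expr1.
  have yi_neq0 : y i != 0 by rewrite -Di !expf_neq0.
  have [i' lt_i' Di'] := sqr_closed i lt_i_n yi_neq0.
  by exists i' => //; rewrite expnSr exprM Di.
(* Pigeonhole: [n.+1] iterated squares lie among [n] values. Cancelling norms of two equal ones
   leaves a positive power of [|x 0|] equal to 1. *)
have /(uniqPn 0)[i [j []]] : ~~ uniq [seq y 0 ^+ (2 ^ m) | m <- iota 0 n.+1].
  apply/negP => uniq_orbit.
  suff /(uniq_leq_size uniq_orbit) :
      {subset [seq y 0 ^+ (2 ^ m) | m <- iota 0 n.+1] <= [seq y i | i <- iota 0 n]}.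
    by rewrite !size_map !size_iota ltnn.
  move=> _ /mapP[m _ ->]; have [i lt_i_n ->] := orbit m.
  by apply: map_f; rewrite mem_iota.
rewrite size_map size_iota => lt_ij lt_jn.
rewrite !(nth_map 0) ?size_iota ?(ltn_trans lt_ij) // !nth_iota ?(ltn_trans lt_ij) //.
rewrite !add0n -!exprM => /(congr1 Num.norm); rewrite !normrX.
have lt_exp : (2 ^ a * 2 ^ i < 2 ^ a * 2 ^ j)%N.
  by rewrite ltn_pmul2l ?expn_gt0 // ltn_exp2l.
rewrite -(subnK (ltnW lt_exp)) exprD -[LHS]mul1r => /mulIf.
rewrite expf_neq0 ?normr_eq0 // => /(_ isT)/esym/eqP.
by rewrite pexpr_eq1 ?subn_gt0 // => /eqP.
Qed.

End SmallHouse.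

(** * Parry polynomials are monic with nonzero constant term *)

Section ParryPolynomial.
Variable t : nat -> int.

Lemma size_digit_sum m N : (0 < N)%N ->
  (size (\sum_(1 <= i < m) t i *: 'X^(N - i))%R <= N)%N.
Proof.
move=> N_gt0; rewrite big_seq; apply: (leq_trans (size_sum _ _ _)).
apply/bigmax_leqP_seq => i; rewrite mem_index_iota => /andP[i_gt0 _] _.
by apply: leq_trans (size_scale_leq _ _) _; rewrite size_polyXn; lia.
Qed.

Lemma coef0_digit_sum N : (0 < N)%N ->
  (\sum_(1 <= i < N.+1) t i *: 'X^(N - i))`_0 = t N.
Proof.
move=> N_gt0; rewrite big_nat_recr //= subnn coefD coefZ coefXn mulr1.
rewrite coef_sum big_nat big1 ?add0r // => i /andP[_ lt_i_N].
by rewrite coefZ coefXn eq_sym subn_eq0 leqNgt lt_i_N mulr0.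
Qed.

Lemma monic_XnD N (r : {poly int}) : (size r <= N)%N -> 'X^N + r \is monic.
Proof.
move=> le_r_N; rewrite monicE lead_coefDl ?lead_coefXn //.
by rewrite size_polyXn.
Qed.

Lemma monic_simple_parry_poly m :
  finite_of_length t m -> simple_parry_poly t m \is monic.
Proof. by case=> m_gt0 _ _; rewrite monic_XnD // size_polyN size_digit_sum. Qed.

Lemma coef0_simple_parry_poly m :
  finite_of_length t m -> (simple_parry_poly t m)`_0 != 0.
Proof.
case=> m_gt0 tm _; rewrite coefB coefXn ltn_eqF // sub0r oppr_eq0.
by rewrite coef0_digit_sum.
Qed.

Lemma monic_nonsimple_parry_poly m p : nonsimple_parry_poly t m p \is monic.
Proof.
rewrite /nonsimple_parry_poly; case: (m =P 0%N) => [_|/eqP m_neq0].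
  rewrite -addrA monic_XnD // (leq_trans (size_polyD _ _)) // geq_max !size_polyN.
  by rewrite size_digit_sum // (leq_trans (size_polyC_leq1 _)).
rewrite -!addrA monic_XnD // (leq_trans (size_polyD _ _)) // geq_max size_polyN.
rewrite size_digit_sum ?addnS //= (leq_trans (size_polyD _ _)) // geq_max.
rewrite size_polyN size_polyXn ltnS leq_addr /=.
by rewrite (leq_trans (size_digit_sum _ _)) ?lt0n // leqW ?leq_addr.
Qed.

(** For [m = 0] the constant term is at most -1. Otherwise it is [t m - t (m + p.+1)], and its
    vanishing would shorten the preperiod to [m - 1]. *)
Lemma coef0_nonsimple_parry_poly m p :
    (forall i, 0 <= t i) -> minimal_preperiod_period t m p.+1 ->
  (nonsimple_parry_poly t m p)`_0 != 0.
Proof.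
move=> t_ge0 [[_ per] min_mp]; rewrite /nonsimple_parry_poly.
case: (m =P 0%N) => [_|/eqP m_neq0].
  rewrite !coefB coefXn coefC /= coef_sum big_nat big1 => [|i /andP[_ lt_i]].
    by have := t_ge0 p.+1; lia.
  by rewrite coefZ coefXn eq_sym subn_eq0 leqNgt lt_i mulr0.
rewrite coefD !coefB !coefXn !coef0_digit_sum ?addnS ?lt0n //.
rewrite !ltn_eqF ?lt0n // subr0 sub0r addrC subr_eq0.
case: m m_neq0 per min_mp => // m _ per min_mp; apply/eqP => eq_t.
have [|] := min_mp m p.+1; last by rewrite ltnn.
split=> // i; rewrite leq_eqVlt => /predU1P[<-|/per//].
by rewrite addnS.
Qed.

End ParryPolynomial.

Lemma beta_digit_ge0 (R : realType) (b : R) i : 1 < b -> 0 <= beta_digit b i.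
Proof.
move=> b_gt1; have b_ge0 : 0 <= b := ltW (lt_trans ltr01 b_gt1).
rewrite /beta_digit floor_ge0 mulr_ge0 //.
case: i.-1 => //= j; by rewrite /beta_map subr_ge0 floor_le.
Qed.

Lemma parry_poly_monic_coef0 (R : realType) (b : R) (q : {poly int}) :
  1 < b -> is_parry_poly b q -> q \is monic /\ q`_0 != 0.
Proof.
move=> b_gt1 [[m fin_m ->]|[_ [m [p [min_mp ->]]]]].
  by split; [apply: monic_simple_parry_poly|apply: coef0_simple_parry_poly].
split; first exact: monic_nonsimple_parry_poly.
by apply: coef0_nonsimple_parry_poly => // i; apply: beta_digit_ge0.
Qed.

(** * Integrality of the minimal polynomial and conclusion *)

(** Gauss's lemma: the integer factors of [q] have mutually inverse leading coefficients, so a unit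
    rescaling makes [p] equal to [P]. *)
Lemma monic_dvdp_int (P : {poly rat}) (q : {poly int}) :
    P \is monic -> q \is monic -> P %| map_poly intr q ->
  exists p : {poly int}, P = map_poly intr p.
Proof.
move=> P_monic q_monic /dvdpP_rat_int[p [a a_neq0 DP] [r Dq]].
have Dpr : lead_coef p * lead_coef r = 1.
  by apply/eqP; rewrite -lead_coefM -Dq -monicE.
have Da : a * (lead_coef p)%:~R = 1.
  move: P_monic; rewrite DP monicE lead_coefZ lead_coef_map_inj //; first by move/eqP.
  exact: intr_inj.
exists (lead_coef r *: p); rewrite DP map_polyZ /=; congr (_ *: _).
have -> : a = a * (lead_coef p * lead_coef r)%:~R by rewrite Dpr mulr1.
by rewrite rmorphM mulrA Da mul1r.
Qed.

Lemma map_poly_ratr_intr (F : numFieldType) (p : {poly int}) :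
  map_poly ratr (map_poly intr p : {poly rat}) = map_poly intr p :> {poly F}.
Proof. by rewrite -map_poly_comp; apply: eq_map_poly => c /=; rewrite ratr_int. Qed.

Theorem theorem3p17 (R : realType) (b : R) (chi : R[i])
    (P : {poly rat}) (n : nat) (chi_ : nat -> R[i])
    (b_parry : parry_number b)
    (chi_conj : beta_conjugate b chi)
    (P_min : is_minpoly P chi)
    (P_deg : size P = n.+1)
    (P_noncyclo : ~ is_cyclotomic P)
    (chi_0 : chi_ 0%N = chi)
    (chi_roots : map_poly ratr P = \prod_(j < n) ('X - (chi_ j)%:P))
    (chi_le : forall j, (j < n)%N ->
       `|chi_ j| <= 1 + (1 / 10%:R) / n%:R ^+ 2) :
  exists2 j, (j < n)%N & `|chi_ j| = 1.
Proof.
case: b_parry => b_gt1 _ _; case: chi_conj => -[q q_parry q_chi] _.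
have [q_monic q0_neq0] := parry_poly_monic_coef0 b_gt1 q_parry.
have chi_neq0 : chi != 0.
  apply: contraNneq q0_neq0 => chi0; move: q_chi.
  by rewrite chi0 rootE horner_coef0 coef_map intr_eq0.
have n_gt0 : (0 < n)%N.
  have: root (map_poly ratr P) chi by rewrite (P_min.2 P) dvdpp.
  by case: (posnP n) chi_roots => // -> ->; rewrite big_ord0 (negPf (root1 _)).
have [p DP] : exists p : {poly int}, P = map_poly intr p.
  apply: monic_dvdp_int P_min.1 q_monic _.
  by rewrite -P_min.2 map_poly_ratr_intr.
(* The conjugate found is [chi] itself; [r] is [p] with its coefficients reversed. *)
exists 0%N => //; pose r : {poly int} := \poly_(i < n.+1) p`_(n - i).
apply: (@norm_small_house _ n chi_ r) => //; last by rewrite chi_0.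
apply/polyP => i; rewrite coef_map coef_poly ltnS; case: leqP => [le_i_n|lt_n_i].
  by rewrite coef_recip_prod // -chi_roots DP map_poly_ratr_intr coef_map.
by rewrite nth_default // (leq_trans (size_recip_prod _ _)).
Qed.
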